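(* The family of all Haar-finite subsets of $\mathbb{R}$ is not an ideal on $\mathbb{R}$.
   Context: A Cantor set is a homeomorphic copy of $2^\omega$ (the Cantor space). A set $A\subseteq\mathbb{R}$ is Haar-finite if there are a Borel set $B\subseteq\mathbb{R}$ with $A\subseteq B$ and a Cantor set $C\subseteq\mathbb{R}$ such that $(C+x)\cap B$ is finite for all $x\in\mathbb{R}$. An ideal on a set $X$ is a collection of subsets of $X$ closed under taking subsets and finite unions. *)

(* Defs.v *)
From mathcomp Require Import all_boot all_order all_algebra.
From mathcomp Require Import all_classical all_reals all_analysis.
Import numFieldNormedType.Exports.

Set Implicit Arguments.
Unset Strict Implicit.
Unset Printing Implicit Defensive.

Local Open Scope classical_set_scope.
Local Open Scope ring_scope.

(* [f] is a homeomorphism from [cantor_space] onto the subspace [C], with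
   inverse [g]; the values of [g] outside [C] are irrelevant. *)
Definition Cantor_set (T : topologicalType) (C : set T) : Prop :=
  exists (f : cantor_space -> T) (g : T -> cantor_space),
    [/\ continuous f, {within C, continuous g}, range f = C & cancel f g].

Definition Borel_set (T : topologicalType) (B : set T) : Prop :=
  <<s [set U : set T | open U] >> B.

Definition translate (R : realType) (C : set R) (x : R) : set R :=
  [set c + x | c in C].

Definition Haar_finite (R : realType) (A : set R) : Prop :=
  exists2 B : set R, Borel_set B /\ A `<=` B &
  exists2 C : set R, Cantor_set C &
    forall x : R, finite_set (translate C x `&` B).

(* The union of the empty family is allowed, so an ideal contains [set0]. *)
Definition is_ideal (X : Type) (I : set (set X)) : Prop :=
  (forall A B : set X, A `<=` B -> I B -> I A) /\
  (forall F : set (set X), finite_set F -> F `<=` I -> I (\bigcup_(A in F) A)).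

(* Main.v *)
Require Import Defs.
From mathcomp Require Import all_boot all_order all_algebra.
From mathcomp Require Import all_classical all_reals all_analysis.
From mathcomp Require Import ring lra.
Import numFieldNormedType.Exports.
Import Order.TTheory GRing.Theory Num.Theory.

(* For a rapidly growing sequence of levels, let A be an intersection of
   "combs", one per level i: no two points of A are at a distance of the order
   of s_i, where s_i decreases rapidly.  The distances between points of the
   Cantor set of all subset sums of (s_i) are of the order of some s_i, so each
   of its translates meets the closure of A in at most one point.  On the other
   hand A contains a translate of every sufficiently sparse null sequence none
   of whose terms matches the scale of a level.  Split one sequence of levels
   into the even and the odd ones: a nonzero real matches at most one level, so
   every null sequence has a subsequence that avoids the even levels or one that
   avoids the odd levels.  Hence every Cantor set has a translate with infinitely
   many points in the union of the two sets, which is not Haar-finite. *)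

Local Open Scope classical_set_scope.
Local Open Scope ring_scope.

(** * Combs and the forbidden distances between their points *)

Section Comb.
Variable R : realType.
Implicit Types (L w n : nat) (l : nat -> nat) (y z : R).

(** The exponent fits [lacunary_approx]: solving the congruences of the [3 * L + 1] cells leaves an
    interval of length [2 / base_freq L], which contains a multiple of [1 / base_freq L]. *)
Definition base_freq L : R := 64 ^+ (3 * L).+2.

Definition freq L w : R := base_freq L + 64 ^+ w.+1.

Definition scale L : R := base_freq L * L%:R.

(* On each unit cell [w, w + 1] the fractional part of [freq L w * (L * y)] is
   required to be small.  The frequencies are integers, so these fractional
   parts agree where two cells meet; they are all of the order of [base_freq L],
   which separates the points of the comb, but they differ by a lacunary
   sequence, which makes the conditions on distinct cells independent. *)
Definition comb L : set R := [set y | exists (w : nat) (k : int),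
  [/\ (w <= 3 * L)%N, w%:R <= L%:R * y <= w%:R + 1 &
      k%:~R <= freq L w * (L%:R * y) <= k%:~R + 3 / 64]].

Lemma base_freq_gt0 L : 0 < base_freq L.
Proof. by rewrite exprn_gt0. Qed.

Lemma scale_gt0 L : (0 < L)%N -> 0 < scale L.
Proof. by move=> L0; rewrite mulr_gt0 ?base_freq_gt0 ?ltr0n. Qed.

Lemma scale_ge L : (0 < L)%N -> L%:R <= scale L.
Proof. by move=> L0; rewrite ler_peMl ?ler0n// exprn_ege1// ler1n. Qed.

Lemma freq_bounds L w : (w <= 3 * L)%N -> base_freq L <= freq L w <= 2 * base_freq L.
Proof.
move=> wL; have : (64 : R) ^+ w.+1 <= base_freq L.
  by rewrite ler_eXn2l ?ltr1n// ltnS ltnW// ltnS.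
have : 0 < (64 : R) ^+ w.+1 by rewrite exprn_gt0.
by rewrite /freq => *; apply/andP; split; lra.
Qed.

Lemma freq_int L w : freq L w \is a Num.int.
Proof. by rewrite rpredD// rpredX// natr_int. Qed.

(** Meant for [S] the increase of the phase between two points of a comb: [S] is at most [3 / 64] if
    [k <= 0] and at least [61 / 64] otherwise, while [N * d] equals [S] up to a factor 2. *)
Lemma near_int_gap (N d S : R) (k : int) : 0 <= N * d <= S -> S <= 2 * (N * d) ->
  k%:~R - 3 / 64 <= S <= k%:~R + 3 / 64 -> N * d <= 1 / 16 \/ 3 / 8 <= N * d.
Proof.
move=> /andP[Nd0 NdS] SNd /andP[kS Sk].
have [k0|k1] := leP k 0.
  have : k%:~R <= 0 :> R by rewrite -(ler_int R) in k0.
  by left; lra.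
have : 1 <= k%:~R :> R by rewrite (ler_int R 1).
by right; lra.
Qed.

Lemma comb_gap L y y' : (0 < L)%N -> comb L y -> comb L y' ->
  scale L * `|y - y'| <= 1 / 16 \/ 3 / 8 <= scale L * `|y - y'|.
Proof.
move=> L0; wlog yy' : y y' / y <= y'.
  by move=> H; have [|/ltW] := leP y y'; [|rewrite distrC => h ? ?]; exact: H.
move=> [w [k [wL /andP[wy yw] /andP[ky yk]]]].
move=> [w' [k' [w'L /andP[wy' yw'] /andP[ky' yk']]]].
have LR0 : 0 < L%:R :> R by rewrite ltr0n.
have N0 := base_freq_gt0 L.
have N1 : 1 <= base_freq L by rewrite exprn_ege1// ler1n.
rewrite distrC ger0_norm ?subr_ge0// /scale -mulrA mulrBr.
set Y := L%:R * y in wy yw ky yk *; set Y' := L%:R * y' in wy' yw' ky' yk' *.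
have YY' : Y <= Y' by rewrite ler_pM2l.
have /andP[fw1 fw2] := freq_bounds L w wL.
have /andP[fw1' fw2'] := freq_bounds L w' w'L.
have [ww'|ww'|ww'] := ltngtP w w'; last first.
- apply: (@near_int_gap _ _ (freq L w * (Y' - Y)) (k' - k)).
  + by apply/andP; split; nra.
  + nra.
  + by rewrite rmorphB /= -ww' in ky' yk' *; apply/andP; split; lra.
(* The cells are in reverse order, so both points are their common endpoint. *)
- have w'w : w'%:R + 1 <= w%:R :> R by rewrite natr1 ler_nat.
  by have -> : Y' - Y = 0; [lra|left; lra].
- have [/eqP ww1|ww1] := boolP (w' == w.+1)%N; last first.
    have : w%:R + 2 <= w'%:R :> R.
      by rewrite -natrD ler_nat addn2 ltn_neqAle eq_sym ww1.
    by right; nra.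
  have w'E : w'%:R = w%:R + 1 :> R by rewrite ww1 natr1.
  (* At the common endpoint the phases of the two cells differ by an integer, so the increase across
     it is still close to an integer. *)
  have /intrP[m mE] : (freq L w - freq L w') * w'%:R \is a Num.int.
    by rewrite rpredM ?rpredB ?freq_int// natr_int.
  apply: (@near_int_gap _ _ (freq L w * (w'%:R - Y) + freq L w' * (Y' - w'%:R)) (k' - k + m)).
  + by apply/andP; split; nra.
  + nra.
  + by rewrite rmorphD rmorphB /= -mE; apply/andP; split; lra.
Qed.

(** * Translating a separated set into one comb *)

(* Coarse to fine: an interval of length [2 / 64 ^ n] contains a solution of
   the [n]th congruence, and the next interval starts at that solution. *)
Lemma lacunary_approx (tau : nat -> R) (alpha : R) n :
  exists beta, [/\ alpha <= beta, beta + 2 / 64 ^+ n.+1 <= alpha + 2 / 64 &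
    forall w, (w < n)%N -> exists k : int, forall X,
      beta <= X <= beta + 2 / 64 ^+ n.+1 ->
      k%:~R <= 64 ^+ w.+1 * X + tau w <= k%:~R + 2 / 64].
Proof.
elim: n => [|n [beta [ab bb IH]]]; first by exists alpha; split.
set p : R := 64 ^+ n.+1 in bb IH *.
have p0 : 0 < p by rewrite exprn_gt0.
have /andP[] := ceil_itv (p * beta + tau n).
set k := Num.ceil _; rewrite rmorphB /= => k1 k2.
pose X0 := (k%:~R - tau n) / p.
have pX0 : p * X0 = k%:~R - tau n by rewrite /X0; field; rewrite gt_eqF.
set e := p^-1 in bb IH *.
have pe : p * e = 1 by rewrite /e mulfV// gt_eqF.
have e0 : 0 < e by rewrite invr_gt0.
have bX : beta <= X0 by rewrite -(ler_pM2l p0); lra.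
have Xb : X0 <= beta + e by rewrite -(ler_pM2l p0); lra.
have eE : 2 / 64 ^+ n.+2 = 2 * e / 64 by rewrite exprSr -/p /e; field; rewrite gt_eqF.
rewrite eE; exists X0; split; [lra|lra|].
move=> w; rewrite ltnS leq_eqVlt => /predU1P[->|wn].
  exists k => X /andP[X1 X2]; rewrite -/p.
  have : p * X0 <= p * X by rewrite ler_pM2l.
  have : p * X <= p * (X0 + 2 * e / 64) by rewrite ler_pM2l.
  by rewrite mulrDr => *; apply/andP; split; lra.
have [k' Hk'] := IH w wn; exists k' => X /andP[X1 X2].
by apply: Hk'; apply/andP; split; lra.
Qed.

(* The integer multiple of [1 / base_freq L] picked at the end makes the common
   summand of all the frequencies invisible modulo 1. *)
Lemma comb_translates L (Z : set R) (a : R) : (0 < L)%N -> 1 <= a -> a + L%:R^-1 <= 2 ->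
  (forall z, Z z -> -1 <= z <= 1) ->
  (forall z z', Z z -> Z z' -> z != z' -> 2 <= L%:R * `|z - z'|) ->
  exists x0, [/\ a <= x0, x0 + (64 * scale L)^-1 <= a + L%:R^-1 &
    forall x z, x0 <= x <= x0 + (64 * scale L)^-1 -> Z z -> comb L (x + z)].
Proof.
move=> L0 a1 a2 Z1 Zsep.
have l0 : 0 < L%:R :> R by rewrite ltr0n.
set l : R := L%:R in l0 a2 Zsep *.
(* [near w z] means that [z] may land in cell [w] for some candidate translation. After scaling by
   [l], points of [Z] are at least 2 apart, so a cell receives at most one; [tau w] is its
   contribution to the phase, or 0 if there is none. *)
pose near w z := exists X, l * a <= X <= l * a + 2 / 64 /\ w%:R <= X + l * z <= w%:R + 1.
have near_uniq w z z' : Z z -> Z z' -> near w z -> near w z' -> z = z'.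
  move=> Zz Zz' [X [/andP[X1 X2] /andP[X3 X4]]] [X' [/andP[X1' X2'] /andP[X3' X4']]].
  apply: contrapT => /eqP zz'; have := Zsep _ _ Zz Zz' zz'.
  by case: ger0P => _; rewrite ?opprB mulrBr; lra.
have /choice[tau tauE] : forall w, exists t, forall z, Z z -> near w z ->
    t = freq L w * (l * z).
  move=> w; have [[z [Zz nz]]|nz] := pselect (exists z, Z z /\ near w z).
    by exists (freq L w * (l * z)) => z' Zz' nz'; rewrite (near_uniq w z z').
  by exists 0 => z Zz nz'; case: nz; exists z.
have [beta [b1 b2 Hb]] := lacunary_approx tau (l * a) (3 * L).+1.
set N := base_freq L.
have N0 : 0 < N := base_freq_gt0 L.
have NE : 64 ^+ (3 * L).+2 = N by [].
rewrite NE in b2 Hb.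
have /andP[] := ceil_itv (N * beta).
set k := Num.ceil _; rewrite rmorphB /= => k1 k2.
have Ne : N * N^-1 = 1 by rewrite mulfV// gt_eqF.
have e0 : 0 < N^-1 by rewrite invr_gt0.
set e := N^-1 in b2 Hb Ne e0 *.
pose X0 := k%:~R * e.
have NX0 : N * X0 = k%:~R by rewrite /X0 mulrCA Ne mulr1.
have bX0 : beta <= X0 by rewrite -(ler_pM2l N0); lra.
have X0b : X0 <= beta + e by rewrite -(ler_pM2l N0); lra.
have lV : l * l^-1 = 1 by rewrite mulfV// gt_eqF.
have lx : l * (X0 / l) = X0 by rewrite mulrCA lV mulr1.
have lm : l * (64 * scale L)^-1 = e / 64.
  by rewrite /scale -/l -/N /e; field; rewrite !gt_eqF.
have e1 : e <= 1/64.
  rewrite -(ler_pM2l N0) Ne; have : 64 <= N; last lra.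
  by rewrite /N /base_freq exprS ler_peMr// exprn_ege1// ler1n.
exists (X0 / l); split.
- by rewrite -(ler_pM2l l0) lx; lra.
- by rewrite -(ler_pM2l l0) !mulrDr lx lm lV; lra.
move=> x z /andP[x1 x2] Zz.
have /andP[z1 z2] := Z1 z Zz.
rewrite -(ler_pM2l l0) lx in x1.
rewrite -(ler_pM2l l0) mulrDr lx lm in x2.
have la : l * a + 1 <= l * 2 by move: a2; rewrite -(ler_pM2l l0) mulrDr lV.
have la1 : l <= l * a by rewrite -[leLHS]mulr1 ler_pM2l.
have lz1 : - l <= l * z by rewrite -[leLHS]mulrN1 ler_pM2l//.
have lz2 : l * z <= l by rewrite -[leRHS]mulr1 ler_pM2l.
have Y0 : 0 <= l * (x + z) by rewrite mulrDr; lra.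
(* Here [x + z] lies between 0 and 3, whence the bound [3 * L] on the cells of [comb]. *)
have /andP[] := truncn_itv Y0; set w := Num.truncn _ => w1; rewrite -natr1 => w2.
have w3 : (w <= 3 * L)%N.
  rewrite -ltnS -(ltr_nat R) -natr1 natrM; apply: le_lt_trans w1 _.
  by rewrite -/l mulrDr; lra.
rewrite mulrDr in w1 w2.
have nz : near w z.
  by exists (l * x); split; apply/andP; split; lra.
have [m Hm] := Hb w w3.
have /andP[m1 m2] := Hm (l * x) ltac:(by apply/andP; split; lra).
exists w, (m + k); split => //; rewrite -/l mulrDr.
  by apply/andP; split; lra.
rewrite mulrDr -(tauE w z Zz nz) /freq -/N rmorphD /=.
(* The common frequency adds at most [1 / 64] to the error [2 / 64] of the lacunary part: this is
   the tolerance [3 / 64] of [comb]. *)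
have NeX : N * (X0 + e / 64) = k%:~R + 1 / 64 by rewrite mulrDr NX0 mulrA Ne.
have : N * X0 <= N * (l * x) by rewrite ler_pM2l.
have : N * (l * x) <= N * (X0 + e / 64) by rewrite ler_pM2l.
by rewrite NeX NX0 => *; apply/andP; split; lra.
Qed.

(** * Sequences of levels and intersections of combs *)

(** Since [1024 = 4 * 256], the ranges [1 / (256 * scale (l i)) < |z| < 4 / l i] of distances
    matching a level are pairwise disjoint. *)
Definition rapidly_growing (l : nat -> nat) :=
  forall i, (0 < l i)%N /\ 1024 * scale (l i) <= (l i.+1)%:R.

Lemma rapidly_growing_exists : exists l, rapidly_growing l.
Proof.
exists (fun i => iter i (fun n => (Num.truncn (1024 * scale n)).+1) 1%N) => i.
split; first by case: i => [|i]; rewrite ?iterS.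
by apply/ltW; rewrite iterS truncnS_gt.
Qed.

Lemma rapidly_growing_le l i j : rapidly_growing l -> (i <= j)%N -> (l i <= l j)%N.
Proof.
move=> lg; elim: j => [|j IH]; first by rewrite leqn0 => /eqP->.
rewrite leq_eqVlt => /predU1P[->//|]; rewrite ltnS => /IH/leq_trans; apply.
have [l0 lS] := lg j; rewrite -(ler_nat R); apply: le_trans lS.
by have := scale_ge (l j) l0; have := scale_gt0 (l j) l0; lra.
Qed.

Lemma rapidly_growing_step l i j : rapidly_growing l -> (i < j)%N ->
  1024 * scale (l i) <= (l j)%:R.
Proof.
move=> lg ij; have [_ /le_trans] := lg i; apply.
by rewrite ler_nat; exact: rapidly_growing_le.
Qed.

Lemma rapidly_growing_sub l (s : nat -> nat) : rapidly_growing l ->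
  (forall i, s i < s i.+1)%N -> rapidly_growing (l \o s).
Proof.
by move=> lg ss i; split=> /=; [have [] := lg (s i)|exact: rapidly_growing_step].
Qed.

Definition comb_cap (l : nat -> nat) : set R := \bigcap_i comb (l i).

(** Both alternatives of [comb_gap] are closed conditions, so they survive in the closure, which
    will be the Borel hull. *)
Lemma closure_comb_cap_gap l i y y' : rapidly_growing l ->
  closure (comb_cap l) y -> closure (comb_cap l) y' ->
  scale (l i) * `|y - y'| <= 1 / 16 \/ 3 / 8 <= scale (l i) * `|y - y'|.
Proof.
move=> lg cy cy'.
have [|D1] := leP (scale (l i) * `|y - y'|) (1 / 16); first by left.
have [|D2] := leP (3 / 8) (scale (l i) * `|y - y'|); first by right.
have [l0 _] := lg i; have s0 := scale_gt0 (l i) l0.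
set s := scale (l i) in D1 D2 s0 *.
pose e := Num.min (s * `|y - y'| - 1 / 16) (3 / 8 - s * `|y - y'|) / (4 * s).
have e0 : 0 < e.
  by apply: divr_gt0; [rewrite lt_min; apply/andP; split; lra|lra].
have se : s * e = Num.min (s * `|y - y'| - 1 / 16) (3 / 8 - s * `|y - y'|) / 4.
  by rewrite /e; field; rewrite gt_eqF.
have [y1 [A1 /= B1]] := cy _ (nbhsx_ballx y e e0).
have [y2 [A2 /= B2]] := cy' _ (nbhsx_ballx y' e e0).
rewrite -ball_normE /= in B1 B2.
have d1 : `|y - y'| <= `|y1 - y2| + (e + e).
  have := ler_normD (y - y1) (y1 - y'); have := ler_normD (y1 - y2) (y2 - y').
  by rewrite !addrA !subrK (distrC y2 y') => *; lra.
have d2 : `|y1 - y2| <= `|y - y'| + (e + e).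
  have := ler_normD (y1 - y) (y - y2); have := ler_normD (y - y') (y' - y2).
  by rewrite !addrA !subrK (distrC y1 y) => *; lra.
have := comb_gap (l i) y1 y2 l0 (A1 i I) (A2 i I); rewrite -/s.
have m1 : s * e <= (s * `|y - y'| - 1 / 16) / 4 by rewrite se ler_pM2r// ge_min lexx.
have m2 : s * e <= (3 / 8 - s * `|y - y'|) / 4.
  by rewrite se ler_pM2r// ge_min lexx orbT.
rewrite -(ler_pM2l s0) !mulrDr in d1.
rewrite -(ler_pM2l s0) !mulrDr in d2.
lra.
Qed.

(** * Translating a sparse set into all the combs at once *)

Section Translates.
Variables (l : nat -> nat) (Z : set R).
Hypothesis lg : rapidly_growing l.
Hypothesis Z0 : Z 0.
Hypothesis Z1 : forall z, Z z -> -1 <= z <= 1.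
Hypothesis Zsep : forall z z', Z z -> Z z' -> z != z' -> `|z| <= 2 * `|z - z'|.
Hypothesis Zlevel : forall i z, Z z ->
  4 <= (l i)%:R * `|z| \/ 256 * scale (l i) * `|z| <= 1.

(* At level [i] the large elements of [Z] are handled by [comb_translates]; the
   small ones are absorbed, like the element [0], by the margin [m]. *)
Let refine i (a : R) : 1 <= a -> a + (l i)%:R^-1 <= 2 ->
  exists b, [/\ a <= b, b + (l i.+1)%:R^-1 <= a + (l i)%:R^-1 &
    forall x z, b <= x <= b + (l i.+1)%:R^-1 -> Z z -> comb (l i) (x + z)].
Proof.
move=> a1 a2; have [l0 lS] := lg i; have s0 := scale_gt0 (l i) l0.
pose Zi := [set z | Z z /\ (z = 0 \/ 4 <= (l i)%:R * `|z|)].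
have [||x0 [x1 x2 Hx]] := comb_translates (l i) Zi a l0 a1 a2.
- by move=> z [/Z1].
- have sep z z' : Zi z -> Zi z' -> z != z' -> z != 0 -> 2 <= (l i)%:R * `|z - z'|.
    move=> [Zz Hz] [Zz' _] zz' z0; case: Hz => [/eqP|h]; first by rewrite (negbTE z0).
    have : (l i)%:R * `|z| <= (l i)%:R * (2 * `|z - z'|).
      by rewrite ler_wpM2l// Zsep.
    by rewrite mulrCA; lra.
  move=> z z' hz hz' zz'; have [z0|] := eqVneq z 0; last exact: sep.
  by rewrite distrC sep// 1?eq_sym// -z0.
pose m := (256 * scale (l i))^-1.
have q0 : 0 < 256 * scale (l i) by lra.
have m0 : 0 < m by rewrite invr_gt0.
have mE : (64 * scale (l i))^-1 = 4 * m by rewrite /m; field; rewrite gt_eqF.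
have lm : (l i.+1)%:R^-1 <= m.
  have m1 : 256 * scale (l i) <= (l i.+1)%:R by lra.
  by rewrite /m lef_pV2 ?posrE ?(lt_le_trans q0 m1).
rewrite mE in x2 Hx.
exists (x0 + m); split; [lra|lra|move=> x z /andP[y1 y2] Zz].
have [h|h] := Zlevel i z Zz.
  by apply: Hx; [apply/andP; split; lra|split=> //; right].
have zm : `|z| <= m.
  by rewrite -[leRHS]mulr1 /m ler_pdivlMl.
rewrite -[x + z]addr0; apply: Hx; last by split => //; left.
by move: zm; rewrite ler_norml => /andP[? ?]; apply/andP; split; lra.
Qed.

(** Iterating [refine] gives nested intervals of lengths [1 / l i]; the supremum of their left
    endpoints lies in all of them. *)
Lemma comb_cap_translates : exists x, forall z, Z z -> comb_cap l (x + z).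
Proof.
pose P i (a : R) := 1 <= a /\ a + (l i)%:R^-1 <= 2.
have /choice[F HF] : forall ia : nat * R, exists b, P ia.1 ia.2 ->
    [/\ ia.2 <= b, b + (l ia.1.+1)%:R^-1 <= ia.2 + (l ia.1)%:R^-1 &
    forall x z, b <= x <= b + (l ia.1.+1)%:R^-1 -> Z z -> comb (l ia.1) (x + z)].
  move=> [i a] /=; have [[a1 a2]|] := pselect (P i a); last by exists 0.
  by have [b] := refine i a a1 a2; exists b.
pose u := fix u i := if i is j.+1 then F (j, u j) else 1.
have lV i : 0 < (l i)%:R^-1 :> R by have [? _] := lg i; rewrite invr_gt0 ltr0n.
have uP i : P i (u i).
  elim: i => [|i IH].
    split => //=; have [l0 _] := lg 0.
    by rewrite -[leRHS]/(1 + 1) lerD2l invf_le1 ?ler1n ?ltr0n.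
  by have /= [h1 h2 _] := HF (i, u i) IH; case: IH => ? ?; split => /=; lra.
have uS i := HF (i, u i) (uP i).
have u_le i j : (i <= j)%N -> u i <= u j.
  elim: j => [|j IH]; first by rewrite leqn0 => /eqP->.
  rewrite leq_eqVlt => /predU1P[->//|]; rewrite ltnS => /IH/le_trans; apply.
  by have [] := uS j.
have v_le i j : (i <= j)%N -> u j + (l j)%:R^-1 <= u i + (l i)%:R^-1.
  elim: j => [|j IH]; first by rewrite leqn0 => /eqP->.
  rewrite leq_eqVlt => /predU1P[->//|]; rewrite ltnS => /IH; apply: le_trans.
  by have [] := uS j.
have uv i j : u i <= u j + (l j)%:R^-1.
  have := u_le _ _ (leq_maxl i j); have := v_le _ _ (leq_maxr i j).
  by have := lV (maxn i j); lra.
have ubu j : ubound (range u) (u j + (l j)%:R^-1) by move=> _ [i _ <-].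
exists (sup (range u)) => z Zz i _; have [_ _] := uS i; apply => //.
apply/andP; split.
  by apply: ub_le_sup; [exists (u 0 + (l 0)%:R^-1)|exists i.+1].
by apply: ge_sup; [exists (u 0), 0%N|exact: (ubu i.+1)].
Qed.

End Translates.

(** * The Cantor set of subset sums *)

Lemma first_difference (a b : nat -> bool) : a <> b ->
  exists2 n, a n != b n & forall i, (i < n)%N -> a i = b i.
Proof.
move=> ab; have ex : exists n, a n != b n.
  apply: contrapT => h; apply: ab; apply/funext => n; apply: contrapT => abn.
  by apply: h; exists n; apply/eqP.
exists (ex_minn ex); case: ex_minnP => // n _ min i ni; apply/eqP; rewrite -[_ == _]negbK.
by apply/negP => /min; rewrite leqNgt ni.
Qed.

Lemma near_prefix (a : cantor_space) n :
  \forall b \near a, forall i, (i < n)%N -> a i = b i.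
Proof.
elim: n => [|n IH]; first by near=> b => i; rewrite ltn0.
have an : \forall b \near a, b n = a n.
  have := @proj_continuous _ (fun _ : nat => bool) n a [set a n].
  by apply; exact: discrete_set1.
near=> b => i; rewrite ltnS leq_eqVlt => /predU1P[->|ni]; first by apply/esym; near: b.
by rewrite (near IH b).
Unshelve. all: by end_near. Qed.

Section SubsetSums.
Variable s : nat -> R.
Hypothesis s0 : forall i, 0 < s i.
Hypothesis s4 : forall i, 4 * s i.+1 <= s i.

Let psum (a : nat -> bool) n := \sum_(i < n) (a i)%:R * s i.

Let psumS a n : psum a n.+1 = psum a n + (a n)%:R * s n.
Proof. by rewrite /psum big_ord_recr. Qed.

Let psum_le a m n : (m <= n)%N -> psum a m <= psum a n.
Proof.
elim: n => [|n IH]; first by rewrite leqn0 => /eqP->.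
rewrite leq_eqVlt => /predU1P[->//|]; rewrite ltnS => /IH/le_trans; apply.
by rewrite psumS lerDl mulr_ge0// ltW.
Qed.

(** The terms from [n] on are dominated by a geometric series of ratio [1 / 4], whose sum is
    [4 / 3 * s n]. *)
Let psum_tail a m n : (m <= n)%N -> psum a n + 4 / 3 * s n <= psum a m + 4 / 3 * s m.
Proof.
elim: n => [|n IH]; first by rewrite leqn0 => /eqP->.
rewrite leq_eqVlt => /predU1P[->//|]; rewrite ltnS => /IH; apply: le_trans.
rewrite psumS; have := s4 n; have := s0 n.
by case: (a n) => /= *; lra.
Qed.

Definition subset_sum (a : nat -> bool) : R := sup (range (psum a)).

Let psum_lub a m n : psum a m <= psum a n + 4 / 3 * s n.
Proof.
have := psum_le a _ _ (leq_maxl m n); have := psum_tail a _ _ (leq_maxr m n).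
by have := s0 (maxn m n); lra.
Qed.

Let subset_sum_bounds a n : psum a n <= subset_sum a <= psum a n + 4 / 3 * s n.
Proof.
have ub m : ubound (range (psum a)) (psum a m + 4 / 3 * s m) by move=> _ [k _ <-].
apply/andP; split; first by apply: ub_le_sup; [eexists; exact: (ub 0%N)|exists n].
by apply: ge_sup; [exists (psum a 0), 0%N|exact: ub].
Qed.

Let psum_eq a b n : (forall i, (i < n)%N -> a i = b i) -> psum a n = psum b n.
Proof. by move=> ab; apply: eq_bigr => i _; rewrite ab. Qed.

Lemma subset_sum_near a b n : (forall i, (i < n)%N -> a i = b i) ->
  `|subset_sum a - subset_sum b| <= 4 / 3 * s n.
Proof.
move=> /psum_eq ab; have /andP[] := subset_sum_bounds a n.
have /andP[] := subset_sum_bounds b n.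
by rewrite ab ler_norml => *; apply/andP; split; lra.
Qed.

(** The term [s n] outweighs the later ones, whose total is at most
    [4 / 3 * s n.+1 <= 1 / 3 * s n]. *)
Lemma subset_sum_far a b n : (forall i, (i < n)%N -> a i = b i) -> a n != b n ->
  2 / 3 * s n <= `|subset_sum a - subset_sum b|.
Proof.
wlog [an bn] : a b / a n /\ b n = false.
  move=> H ab abn; have [[an bn]|[an bn]] : a n /\ b n = false \/ b n /\ a n = false.
  - by case: (a n) (b n) abn => [] []; auto.
  - exact: H.
  - by rewrite distrC; apply: H => // [i /ab|]; rewrite ?an ?bn.
move=> /psum_eq ab _; have /andP[+ _] := subset_sum_bounds a n.+1.
have /andP[_ +] := subset_sum_bounds b n.+1; have := s4 n.
rewrite !psumS an bn ab /= mul1r mul0r => h1 h2 h3.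
by apply: le_trans (ler_norm _); lra.
Qed.

Let s_small (e : R) : 0 < e -> exists n, s n < e.
Proof.
move=> e0; have sn n : s n * n.+1%:R <= s 0%N.
  elim: n => [|n IH]; first by rewrite mulr1.
  apply: le_trans IH; rewrite -[n.+2%:R]natr1; have := s4 n; have := s0 n.+1.
  have : 1 <= n.+1%:R :> R by rewrite ler1n.
  by nra.
exists (Num.truncn (s 0%N / e)).
set n := Num.truncn _; have : s 0%N / e < n.+1%:R by exact: truncnS_gt.
rewrite ltr_pdivrMr// => h; rewrite -(ltr_pM2r (ltr0Sn R n)).
by apply: le_lt_trans (sn n) _; rewrite mulrC.
Qed.

Let s_le m n : (m <= n)%N -> s n <= s m.
Proof.
elim: n => [|n IH]; first by rewrite leqn0 => /eqP->.
rewrite leq_eqVlt => /predU1P[->//|]; rewrite ltnS => /IH; apply: le_trans.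
by have := s4 n; have := s0 n; have := s0 n.+1; lra.
Qed.

Lemma Cantor_set_subset_sum : Cantor_set (range (subset_sum : cantor_space -> R)).
Proof.
pose f : cantor_space -> R := subset_sum.
have finj : injective f.
  move=> a b fab; apply: contrapT => /first_difference[n abn ab].
  have := subset_sum_far a b n ab abn; have := s0 n.
  by rewrite -/(f a) fab subrr normr0 => *; lra.
have /choice[g gP] : forall y, exists a, forall b, f b = y -> b = a.
  move=> y; have [[a <-]|h] := pselect (exists a, f a = y).
    by exists a => b /finj.
  by exists point => b fb; case: h; exists b.
have fK : cancel f g by move=> a; rewrite -(gP (f a) a).
exists f, g; split => //.
- move=> a; apply/cvgrPdist_lt => e e0.
  have [n sn] := s_small (e / 2) ltac:(lra).
  apply: filterS (near_prefix a n) => b /subset_sum_near ab.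
  by apply: le_lt_trans ab _; have := s0 n; lra.
- apply/subspace_continuousP => _ [a _ <-]; rewrite /from_subspace -/(f a) fK.
  apply/pointwise_cvgP => n; apply/discrete_cvg.
  (* The inverse is continuous digit by digit: sums closer than [2 / 3 * s n] cannot first differ at
     an index up to [n]. *)
  change (nbhs (f a) (fun y => range f y -> g y n = a n)).
  apply/nbhs_ballP; exists (2 / 3 * s n) => /=.
    by have := s0 n; lra.
  move=> y /= + [b _ yE]; rewrite -yE -ball_normE /= -/(f b) fK => fab.
  apply: contrapT => ab; have /first_difference[m abm abe] : b <> a.
    by move=> ba; apply: ab; rewrite ba.
  have mn : (m <= n)%N by rewrite leqNgt; apply/negP => /abe.
  have := subset_sum_far b a m abe abm; have := s_le _ _ mn.
  by rewrite distrC -/(f a) -/(f b) => *; lra.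
Qed.

End SubsetSums.

(** * Intersections of combs are Haar-finite *)

Let gap l i : R := (4 * scale (l i))^-1.

Let scale_gap l i : rapidly_growing l -> scale (l i) * gap l i = 1 / 4.
Proof.
move=> lg; have [l0 _] := lg i; have s0 := scale_gt0 (l i) l0.
by rewrite /gap; field; rewrite gt_eqF.
Qed.

Lemma comb_cap_Haar_finite l : rapidly_growing l -> Haar_finite (comb_cap l).
Proof.
move=> lg.
have sl i : 0 < scale (l i) by have [l0 _] := lg i; exact: scale_gt0.
have g0 i : 0 < gap l i.
  by rewrite -(pmulr_rgt0 _ (sl i)) scale_gap//; lra.
have g4 i : 4 * gap l i.+1 <= gap l i.
  have h : 4 * scale (l i) <= scale (l i.+1).
    have [l0 _] := lg i.+1; apply: le_trans (scale_ge _ l0).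
    by apply: le_trans (rapidly_growing_step _ _ _ lg (ltnSn i)); have := sl i; lra.
  rewrite -(ler_pM2l (sl i)) scale_gap//.
  have := g0 i.+1; have := scale_gap l i.+1 lg; nra.
exists (closure (comb_cap l)).
  split; last exact: subset_closure.
  move=> M [[_ MD _] oM]; rewrite -[closure _]setCK -setTD.
  by apply: MD; apply: oM; apply: closed_openC; exact: closed_closure.
exists (range (subset_sum (gap l) : cantor_space -> R)).
  exact: Cantor_set_subset_sum.
move=> x; set S := _ `&` _.
have S1 p q : S p -> S q -> p = q.
  move=> [[_ [a _ <-] <-] cp] [[_ [b _ <-] <-] cq].
  have [->//|/first_difference[n abn ab]] := pselect ((a : nat -> bool) = b).
  have := closure_comb_cap_gap l n _ _ lg cp cq.
  rewrite opprD addrACA subrr addr0 => h.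
  (* Multiplied by [scale (l n)], the distance is between [1 / 6] and [1 / 3], inside the forbidden
     range from [1 / 16] to [3 / 8]. *)
  have h1 := subset_sum_near (gap l) g0 g4 a b n ab.
  have h2 := subset_sum_far (gap l) g0 g4 a b n ab abn.
  rewrite -(ler_pM2l (sl n)) [leRHS]mulrCA scale_gap// in h1.
  rewrite -(ler_pM2l (sl n)) [leLHS]mulrCA scale_gap// in h2.
  by exfalso; lra.
have [[p Sp]|nS] := pselect (exists p, S p).
  by apply: (sub_finite_set _ (finite_set1 p)) => q Sq; exact: S1.
by apply: (sub_finite_set _ (finite_set0 R)) => q Sq; case: nS; exists q.
Qed.

(** * The union over both parities is not Haar-finite *)

(** The Cantor space is perfect, and injective continuous maps preserve limit points. *)
Lemma Cantor_set_limit_point (C : set R) : Cantor_set C ->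
  exists2 c, C c & forall e : R, 0 < e -> exists c', [/\ C c', c' != c & `|c' - c| < e].
Proof.
move=> [f [g [fc _ <- fK]]]; exists (f point); first by exists point.
move=> e e0; have [_ limT] := cantor_perfect.
have : limit_point [set: cantor_space] point by rewrite limT.
have /fc/= := nbhsx_ballx (f point) e e0.
move=> nb /(_ _ nb)[a [ap _ fa]]; exists (f a); split; first by exists a.
  by apply: contraNneq ap => /(can_inj fK) ->.
by move: fa; rewrite -ball_normE /= distrC.
Qed.

(** This is the hypothesis [Zlevel] for a single point. *)
Let good l z := forall i, 4 <= (l i)%:R * `|z| \/ 256 * scale (l i) * `|z| <= 1.

(* A point fails to be good only at a level [i] whose scale matches it, and
   there is at most one such level. *)
Let good_parity l z : rapidly_growing l ->
  exists b : bool, good (l \o fun i => i.*2 + b)%N z.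
Proof.
move=> lg; pose bad i := (l i)%:R * `|z| < 4 /\ 1 < 256 * scale (l i) * `|z|.
have good_bad (t : nat -> nat) : (forall i, ~ bad (t i)) -> good (l \o t) z.
  move=> nb i /=; have [|h1] := leP 4 ((l (t i))%:R * `|z|); first by left.
  have [|h2] := leP (256 * scale (l (t i)) * `|z|) 1; first by right.
  by case: (nb i).
have bad_lt i j : bad i -> bad j -> (i < j)%N -> False.
  move=> [_ bi] [bj _] /(rapidly_growing_step _ _ _ lg) h.
  have : 1024 * scale (l i) * `|z| <= (l j)%:R * `|z| by rewrite ler_wpM2r.
  by lra.
have [[i bi]|nb] := pselect (exists i, bad i).
  (* Keep the levels whose parity differs from that of the bad level. *)
  exists (~~ odd i); apply: good_bad => j bj.
  have [ij|ji|ij] := ltngtP i (j.*2 + ~~ odd i)%N;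
    [exact: bad_lt _ _ bi bj ij|exact: bad_lt _ _ bj bi ji|].
  by have := congr1 odd ij; rewrite oddD odd_double /=; case: (odd i).
by exists false; apply: good_bad => j bj; apply: nb; exists (j.*2 + false)%N.
Qed.

Lemma comb_cap_setU_not_Haar_finite l : rapidly_growing l ->
  ~ Haar_finite (\bigcup_(b : bool) comb_cap (l \o fun i => i.*2 + b)%N).
Proof.
move=> lg [B [_ AB] [C /Cantor_set_limit_point[c Cc limc] finC]].
(* Pigeonhole: if both parities failed near [c], a point of [C] within both radii would contradict
   [good_parity]. *)
have [b bP] : exists b : bool, forall e : R, 0 < e -> exists z,
    [/\ C (c + z), z != 0, `|z| < e & good (l \o fun i => i.*2 + b)%N z].
  apply: contrapT => /forallNP nb.
  have {}nb (b : bool) : exists e : R, 0 < e /\ forall z, C (c + z) -> z != 0 -> `|z| < e ->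
      ~ good (l \o fun i => i.*2 + b)%N z.
    have /existsNP[e /not_implyP[e0 /forallNP ne]] := nb b.
    by exists e; split => // z Cz z0 ze gz; apply: (ne z).
  have [e0 [e00 ne0]] := nb false; have [e1 [e10 ne1]] := nb true.
  have [|c' [Cc' c'c]] := limc (Num.min e0 e1); first by rewrite lt_min e00.
  rewrite lt_min => /andP[c'0 c'1].
  have cc' : c + (c' - c) = c' by rewrite addrC subrK.
  have [[] gz] := good_parity l (c' - c) lg.
    by apply: (ne1 (c' - c)) => //; rewrite ?cc'// subr_eq0.
  by apply: (ne0 (c' - c)) => //; rewrite ?cc'// subr_eq0.
set l' := l \o _ in bP.
have lg' : rapidly_growing l'.
  by apply: rapidly_growing_sub => // i; rewrite doubleS addSn ltnS leqnSn.
have /choice[pick pickP] : forall e : R, exists z, 0 < e ->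
    [/\ C (c + z), z != 0, `|z| < e & good l' z].
  move=> e; have [/bP[z]|] := ltP 0 e; first by exists z.
  by exists 0.
(* Halving the absolute values yields the separation [Zsep]; starting below 1 yields [Z1]. *)
pose zeta := fix zeta n := if n is m.+1 then pick (`|zeta m| / 2) else pick 1.
have zP n : [/\ C (c + zeta n), zeta n != 0, `|zeta n| < 1 & good l' (zeta n)].
  elim: n => [|n [_ n0 n1 _]]; first exact: pickP.
  have zn0 : 0 < `|zeta n| by rewrite normr_gt0.
  have [|C' z0 zlt gz] := pickP (`|zeta n| / 2); first lra.
  by split => //=; apply: lt_trans zlt _; lra.
have zS n : `|zeta n.+1| < `|zeta n| / 2.
  have [_ n0 _ _] := zP n; have zn0 : 0 < `|zeta n| by rewrite normr_gt0.
  by have [|] := pickP (`|zeta n| / 2); first lra.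
have zlt m n : (m < n)%N -> `|zeta n| < `|zeta m| / 2.
  elim: n => // n IH; rewrite ltnS leq_eqVlt => /predU1P[->//|/IH].
  by have := zS n; have := normr_ge0 (zeta n); lra.
have zsep n z : z = 0 \/ range zeta z -> zeta n != z -> `|zeta n| <= 2 * `|zeta n - z|.
  have zn0 := normr_ge0 (zeta n).
  move=> [->|[m _ <-]] nm; first by rewrite subr0; lra.
  have := lerB_dist (zeta n) (zeta m); have := lerB_dist (zeta m) (zeta n).
  rewrite (distrC (zeta m)).
  have [mn|mn|mn] := ltngtP m n; last by rewrite mn eqxx in nm.
    by have := zlt _ _ mn; lra.
  by have := zlt _ _ mn; lra.
pose Z := [set z | z = 0 \/ range zeta z].
have [||z z'|i z|x Hx] := @comb_cap_translates l' Z lg'.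
- by left.
- move=> z [->|[n _ <-]]; first lra.
  by have [_ _ + _] := zP n; rewrite ltr_norml => /andP[? ?]; apply/andP; split; lra.
- move=> [->|[n _ <-]] Zz' zz'; first by rewrite normr0 mulr_ge0.
  exact: zsep.
- move=> [->|[n _ <-]]; first by right; rewrite normr0 mulr0.
  by have [_ _ _] := zP n; apply.
(* The translation by [x - c] carries the points [c + zeta n] of [C] into [B], and they are
   infinitely many. *)
have xz n : (translate C (x - c) `&` B) (x + zeta n).
  split; last by apply: AB; exists b => //; apply: Hx; right; exists n.
  by exists (c + zeta n); [have [] := zP n|ring].
have zinj : injective (fun n => x + zeta n).
  have lt_neq m n : (m < n)%N -> zeta m <> zeta n.
    move=> /zlt + e; rewrite e; have := normr_ge0 (zeta n); lra.
  move=> m n /addrI e; apply: contrapT.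
  by move=> /eqP; rewrite neq_ltn => /orP[] /lt_neq; rewrite e.
apply: infinite_nat; apply: (sub_finite_set _ (finite_preimage _ (finC (x - c)))).
  by move=> n _; exact: xz.
by move=> m n _ _ /zinj.
Qed.

End Comb.

Theorem theorem6p1 (R : realType) :
  ~ is_ideal [set A : set R | Haar_finite A].
Proof.
move=> [_ idU]; have [l lg] := rapidly_growing_exists R.
apply: (comb_cap_setU_not_Haar_finite R l lg).
pose F := range (fun b : bool => comb_cap R (l \o fun i => i.*2 + b)%N).
have -> : \bigcup_(b : bool) comb_cap R (l \o fun i => i.*2 + b)%N = \bigcup_(A in F) A.
  by rewrite bigcup_image.
apply: idU; first by apply: finite_image; exact: finite_finset.
move=> _ [b _ <-]; apply: comb_cap_Haar_finite.
by apply: rapidly_growing_sub => // i; rewrite doubleS addSn ltnS leqnSn.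
Qed.
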